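(* If $X$ and $Y$ are uncountable Polish spaces, then $\mathfrak{s}(X)=\mathfrak{s}(Y)$.
   Context: For infinite sets $U, A$, say $U$ splits $A$ if both $A\cap U$ and $A\setminus U$ are infinite. For a topological space $X$, $\mathfrak{s}(X)$ is the smallest cardinality of a family $\mathcal{U}$ of open subsets of $X$ such that every infinite $A\subseteq X$ is split by some $U\in\mathcal{U}$. *)

(* Defs.v *)
From HB Require Import structures.
From mathcomp Require Import all_boot all_order.
From mathcomp Require Import boolp classical_sets functions cardinality topology.
From Stdlib Require Import Reals.

Set Implicit Arguments.
Unset Strict Implicit.
Unset Printing Implicit Defensive.

Local Open Scope classical_set_scope.
Local Open Scope card_scope.

Definition is_metric (T : Type) (d : T -> T -> R) : Prop :=
  (forall x y, (0 <= d x y)%R) /\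
  (forall x y, d x y = 0%R <-> x = y) /\
  (forall x y, d x y = d y x) /\
  (forall x y z, (d x z <= d x y + d y z)%R).

Definition metric_generates (X : topologicalType) (d : X -> X -> R) : Prop :=
  forall A : set X, open A <->
    (forall x, A x -> exists e : R, (0 < e)%R /\
        (forall y, (d x y < e)%R -> A y)).

Definition metric_cauchy (T : Type) (d : T -> T -> R) (u : nat -> T) : Prop :=
  forall e : R, (0 < e)%R -> exists N : nat,
    forall m n : nat, (N <= m)%N -> (N <= n)%N -> (d (u m) (u n) < e)%R.

Definition metric_complete (T : Type) (d : T -> T -> R) : Prop :=
  forall u : nat -> T, metric_cauchy d u ->
    exists l : T, forall e : R, (0 < e)%R -> exists N : nat,
      forall n : nat, (N <= n)%N -> (d (u n) l < e)%R.

Definition completely_metrizable (X : topologicalType) : Prop :=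
  exists d : X -> X -> R, is_metric d /\ metric_generates d /\ metric_complete d.

Definition separable_space (X : topologicalType) : Prop :=
  exists D : set X, countable D /\
    (forall U : set X, open U -> U !=set0 -> (U `&` D) !=set0).

Definition polish (X : topologicalType) : Prop :=
  separable_space X /\ completely_metrizable X.

Definition splits (T : Type) (U A : set T) : Prop :=
  infinite_set (A `&` U) /\ infinite_set (A `\` U).

Definition splitting_family (X : topologicalType) (F : set (set X)) : Prop :=
  (forall U, F U -> open U) /\
  (forall A : set X, infinite_set A -> exists U, F U /\ splits U A).

(* s(X) <= s(Y), with s(Z) the least cardinality of a splitting family of
   open subsets of Z: every splitting family of Y is matched in size by a
   splitting family of X of no larger cardinality. *)
Definition s_le (X Y : topologicalType) : Prop :=
  forall G : set (set Y), splitting_family G ->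
    exists F : set (set X), splitting_family F /\ F #<= G.

Definition s_eq (X Y : topologicalType) : Prop := s_le X Y /\ s_le Y X.

(* Main.v *)
Require Import Defs.
From mathcomp Require Import all_boot all_order.
From mathcomp Require Import boolp classical_sets functions cardinality topology.
From Stdlib Require Import Reals Lra Runcountable.

(* Let G be a splitting family of Y. A Cantor scheme gives a continuous injection h
   of Cantor space into Y, so the sets h^-1(U), U in G, split every infinite subset
   of Cantor space. For a real t, code a point x of X by the bits telling whether x
   lies in the ball of radius exp(t - j) around the i-th point of a dense sequence.
   The coding is injective but not continuous, because of the points lying on one of
   these spheres. A given countable subset A of X, however, meets these spheres only
   for countably many t; for every other t, the preimage of an open set under the
   coding has the same trace on A as some open subset of X. Since countably many sets
   never split all infinite sets, G is uncountable, so there is a family of reals t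
   indexed by G that is contained in no countable set. The open sets obtained from
   pairs (t, U) form a splitting family of X indexed by G x G, which has the
   cardinality of G by Hessenberg's theorem. *)

Set Implicit Arguments.
Unset Strict Implicit.
Unset Printing Implicit Defensive.

Local Open Scope classical_set_scope.
Local Open Scope card_scope.

(** * Cardinal arithmetic *)

Lemma sval_inj (T : Type) (P : T -> Prop) : injective (@sval T P).
Proof. by move=> [x Px] [y Py] /= e; exact: eq_exist. Qed.

(** Zorn's lemma gives a maximal graph of a partial injection. If both a point of [T] and a point of
    [U] were missed, that pair could be added to it; so its domain or its range is everything. *)
Lemma injection_total (T U : Type) :
  (exists f : T -> U, injective f) \/ (exists g : U -> T, injective g).
Proof.
pose P (E : set (T * U)) :=
  (forall x y y', E (x, y) -> E (x, y') -> y = y') /\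
  (forall x x' y, E (x, y) -> E (x', y) -> x = x').
have [F FP Ftot|E [[Efun Einj] Emax]] := @Zorn_bigcup _ P.
  have common s t : (\bigcup_(X in F) X) s -> (\bigcup_(X in F) X) t ->
      exists X, [/\ F X, X s & X t].
    move=> [X FX Xs] [Z FZ Zt]; have [XZ|ZX] := Ftot _ _ FX FZ.
      by exists Z; split=> //; exact: XZ.
    by exists X; split=> //; exact: ZX.
  split=> x y z Ws Wt; have [X [FX Xs Xt]] := common _ _ Ws Wt.
    exact: (FP _ FX).1 Xs Xt.
  exact: (FP _ FX).2 Xs Xt.
have [Edom|/existsNP[x Ex]] := pselect (forall x, exists y, E (x, y)).
  have [f fE] := choice Edom; left; exists f => x x' fxx'.
  by apply: (Einj _ _ (f x)) => //; rewrite fxx'.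
have [Eran|/existsNP[y Ey]] := pselect (forall y, exists x, E (x, y)).
  have [g gE] := choice Eran; right; exists g => y y' gyy'.
  by apply: (Efun (g y)) => //; rewrite gyy'.
exfalso; apply: (Emax (E `|` [set (x, y)])).
  split; first by move=> s; left.
  by move=> /(_ (x, y)) /(_ (or_intror erefl)) Exy; apply: Ex; exists y.
split=> a b c [Eab|[? ?]] [Eac|[? ?]]; subst => //.
- exact: Efun Eab Eac.
- by case: Ex; exists b.
- by case: Ex; exists c.
- exact: Einj Eab Eac.
- by case: Ey; exists a.
- by case: Ey; exists b.
Qed.

(* Hessenberg's theorem: by Zorn, take a maximal injective D * D -> D with D containing
   the range of [u]. If the complement of D embeds in D, then so does T; otherwise
   a copy of D inside the complement allows to extend the map. *)
Lemma injective_square (T : Type) (u : nat -> T) : injective u ->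
  exists f : T -> T -> T, forall x y x' y', f x y = f x' y' -> x = x' /\ y = y'.
Proof.
move=> u_inj.
pose fld (E : set (T * T * T)) x := exists z, E (x, x, z).
(* [Q E]: [E] is the graph of an injection [D * D -> D] with [D := fld E]. *)
pose Q (E : set (T * T * T)) :=
  [/\ forall x y z, E (x, y, z) -> [/\ fld E x, fld E y & fld E z],
      forall x y, fld E x -> fld E y -> exists z, E (x, y, z),
      forall p z z', E (p, z) -> E (p, z') -> z = z' &
      forall p p' z, E (p, z) -> E (p', z) -> p = p'].
pose E0 : set (T * T * T) :=
  [set t | exists i j, t = (u i, u j, u (pickle (i, j)))].
have fld_sub (E E' : set (T * T * T)) x : E `<=` E' -> fld E x -> fld E' x.
  by move=> EE' [z Ez]; exists z; exact: EE'.
have fld0 i : fld E0 (u i) by exists (u (pickle (i, i))), i, i.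
have QE0 : Q E0.
  split.
  - by move=> _ _ _ [i [j [-> -> ->]]]; split.
  - move=> x y [_ [i [_ [-> _ _]]]] [_ [j [_ [-> _ _]]]].
    by exists (u (pickle (i, j))), i, j.
  - by move=> _ _ _ [i [j [-> ->]]] [i' [j' [/u_inj <- /u_inj <- ->]]].
  - move=> _ _ _ [i [j [-> ->]]] [i' [j' [-> /u_inj e]]].
    by have [-> ->] := pcan_inj (@pickleK (nat * nat)%type) e.
(* Adjoining [E0] to every candidate keeps the range of [u] inside the field of the maximal graph;
   [u 0] and [u 1] later serve as two distinct tags. *)
have [F FQ Ftot|M0 [QM Mmax]] := @Zorn_bigcup _ (fun E => Q (E0 `|` E)).
  set W := E0 `|` _.
  have subW X : F X -> E0 `|` X `<=` W.
    by move=> FX t [?|Xt]; [left|right; exists X].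
  have common s t : W s -> W t ->
      exists E, [/\ Q E, E `<=` W, E s & E t].
    move=> [E0s|[X FX Xs]] [E0t|[Z FZ Zt]].
    - by exists E0; split=> // r; left.
    - by exists (E0 `|` Z); split; [exact: FQ|exact: subW|left|right].
    - by exists (E0 `|` X); split; [exact: FQ|exact: subW|right|left].
    - have [XZ|ZX] := Ftot _ _ FX FZ.
        exists (E0 `|` Z).
        by split; [exact: FQ|exact: subW|right; exact: XZ|right].
      exists (E0 `|` X).
      by split; [exact: FQ|exact: subW|right|right; exact: ZX].
  split.
  - move=> x y z Wt; have [E [[QE _ _ _] EW Et _]] := common _ _ Wt Wt.
    by have [? ? ?] := QE _ _ _ Et; split; exact: (fld_sub E).
  - move=> x y [z Wx] [z' Wy].
    have [E [[_ QE _ _] EW Ex Ey]] := common _ _ Wx Wy.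
    by have [|//|v] := QE x y; [exists z|exists z'|exists v; exact: EW].
  - move=> p z z' Ws Wt; have [E [[_ _ QE _] _ Es Et]] := common _ _ Ws Wt.
    exact: QE Es Et.
  - move=> p p' z Ws Wt; have [E [[_ _ _ QE] _ Es Et]] := common _ _ Ws Wt.
    exact: QE Es Et.
set M := E0 `|` M0 in QM.
have {}Mmax N : M `<=` N -> Q N -> N `<=` M.
  move=> MN QN; apply: contrapT => NM; apply: (Mmax N).
    split; first by move=> t M0t; apply: MN; right.
    by move=> NM0; apply: NM => t /NM0; right.
  by rewrite setUidr // => t E0t; apply: MN; left.
have [Mfld Mtot Mfun Minj] := QM.
pose D := fld M.
have Du i : D (u i) by apply: (fld_sub E0) (fld0 i) => t; left.
have [f fM] : exists f : T -> T -> T, forall x y, D x -> D y -> M (x, y, f x y).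
  have /choice[f fM] : forall p : T * T, exists z,
      D p.1 -> D p.2 -> M (p.1, p.2, z).
    move=> [x y]; have [[Dx Dy]|nD] := pselect (D x /\ D y).
      by have [z Mz] := Mtot _ _ Dx Dy; exists z.
    by exists x => /= Dx Dy; case: nD.
  by exists (fun x y => f (x, y)) => x y; exact: (fM (x, y)).
have Df x y : D x -> D y -> D (f x y).
  by move=> Dx Dy; have [] := Mfld _ _ _ (fM _ _ Dx Dy).
have f_inj x y x' y' : D x -> D y -> D x' -> D y' ->
    f x y = f x' y' -> x = x' /\ y = y'.
  move=> Dx Dy Dx' Dy' e; have := fM _ _ Dx Dy; rewrite e => /Minj.
  by move=> /(_ _ (fM _ _ Dx' Dy')) [].
have u01 : u 0 <> u 1 by move=> /u_inj.
have [[g g_inj]|[g g_inj]] := injection_total {x | ~ D x} {x | D x}.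
  (* The complement of [D] embeds in [D]: [T] is then coded inside [D], with the first argument of
     [f] telling whether the coded point was in [D]. *)
  have [k [Dk k_inj]] : exists k : T -> T, (forall x, D (k x)) /\ injective k.
    exists (fun x => match pselect (D x) with
      | left _ => f (u 0) x
      | right nDx => f (u 1) (sval (g (exist _ x nDx))) end).
    split=> [x|x x']; first by
      case: pselect => H; apply: Df => //; exact: (svalP (g _)).
    case: pselect => Dx; case: pselect => Dx'.
    - by move=> /f_inj[].
    - by move=> /f_inj[] //; exact: (svalP (g _)).
    - by move=> /f_inj[] //; [exact: (svalP (g _))|move=> /esym].
    - move=> /f_inj[] //; [exact: (svalP (g _))|exact: (svalP (g _))|].
      by move=> _ e; have [] := g_inj _ _ (sval_inj e).
  exists (fun x y => f (k x) (k y)) => x y x' y' /f_inj[] // /k_inj -> /k_inj.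
  by [].
exfalso.
have [h [nDh h_inj]] : exists h : T -> T, (forall x, D x -> ~ D (h x)) /\
    forall x x', D x -> D x' -> h x = h x' -> x = x'.
  exists (fun x => match pselect (D x) with
      | left Dx => sval (g (exist _ x Dx)) | right _ => x end).
  split=> [x Dx|x x' Dx Dx'].
    by case: pselect => // ?; exact: (svalP (g _)).
  case: pselect => // H; case: pselect => // H' e.
  by have [] := g_inj _ _ (sval_inj e).
pose D' x := D x \/ exists2 v, D v & x = h v.
have [c [Dc c_inj]] : exists c : T -> T, (forall x, D' x -> D (c x)) /\
    forall x x', D' x -> D' x' -> c x = c x' -> x = x'.
  have /choice[c cP] : forall x, exists v,
      (D x -> v = f (u 0) x) /\
      (forall w, D w -> x = h w -> v = f (u 1) w).
    move=> x; have [Dx|nDx] := pselect (D x).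
      by exists (f (u 0) x); split=> // w /nDh + e; rewrite -e.
    have [[w Dw ->]|nh] := pselect (exists2 w, D w & x = h w).
      exists (f (u 1) w); split=> [/(nDh _ Dw)//|w' Dw' /h_inj -> //].
    by exists x; split=> // w Dw e; case: nh; exists w.
  exists c; split=> [x [Dx|[w Dw e]]|x x' [Dx|[w Dw e]] [Dx'|[w' Dw' e']]].
  - by rewrite (cP x).1 //; exact: Df.
  - by rewrite ((cP x).2 w) //; exact: Df.
  - by rewrite (cP x).1 // (cP x').1 // => /f_inj[].
  - by rewrite (cP x).1 // ((cP x').2 w') // => /f_inj[].
  - by rewrite ((cP x).2 w) // (cP x').1 // => /f_inj[] // /esym.
  - rewrite ((cP x).2 w) // ((cP x').2 w') // => /f_inj[] // _.
    by rewrite e e' => ->.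
(* New pairs take values in the image of [D] under [h], outside [D], whereas all values of [M] lie
   in [D]; old and new values cannot collide. Maximality will then force [h (u 0)] into [D]. *)
pose N := M `|` [set t | [/\ D' t.1.1, D' t.1.2,
  ~ (D t.1.1 /\ D t.1.2) & t.2 = h (f (c t.1.1) (c t.1.2))]].
have D'N x : D' x -> fld N x.
  move=> D'x; have [Dx|nDx] := pselect (D x).
    by exists (f x x); left; exact: fM.
  by exists (h (f (c x) (c x))); right; split=> //= -[].
have ND' x : fld N x -> D' x.
  by move=> [z [/Mfld[]|[]//]]; left.
have NM : N `<=` M.
  apply: Mmax; first by move=> t; left.
  split.
  - move=> x y z [/Mfld[Dx Dy Dz]|/= [D'x D'y _ ->]].
      by split; apply: D'N; left.
    split; apply: D'N => //; right; exists (f (c x) (c y)) => //.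
    by apply: Df; exact: Dc.
  - move=> x y /ND' D'x /ND' D'y; have [[Dx Dy]|nD] := pselect (D x /\ D y).
      by exists (f x y); left; exact: fM.
    by exists (h (f (c x) (c y))); right.
  - move=> [x y] z z' [Mz|/= [_ _ nD ->]] [Mz'|/= [_ _ nD' ->]] //.
    + exact: Mfun Mz Mz'.
    + by have [Dx Dy _] := Mfld _ _ _ Mz; case: nD'.
    + by have [Dx Dy _] := Mfld _ _ _ Mz'; case: nD.
  - move=> [x y] [x' y'] z [Mz|/= [D'x D'y nD ->]] [Mz'|/= [D'x' D'y' nD' ez]].
    + exact: Minj Mz Mz'.
    + have [_ _ Dz] := Mfld _ _ _ Mz; exfalso; rewrite ez in Dz.
      by apply: nDh Dz; apply: Df; exact: Dc.
    + have [_ _ Dz] := Mfld _ _ _ Mz'; exfalso.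
      by apply: nDh Dz; apply: Df; exact: Dc.
    + have /h_inj : h (f (c x) (c y)) = h (f (c x') (c y')) by [].
      move=> /(_ (Df _ _ (Dc _ D'x) (Dc _ D'y)) (Df _ _ (Dc _ D'x') (Dc _ D'y'))).
      move=> /f_inj[]; try exact: Dc.
      by move=> /c_inj -> // /c_inj ->.
have D'h : D' (h (u 0)) by right; exists (u 0).
apply: (nDh (u 0)) => //.
by have [z /NM/Mfld[]] := D'N _ D'h.
Qed.

Lemma countable_enum (T : Type) (x0 : T) (A : set T) : countable A ->
  exists e : nat -> T, forall x, A x -> exists n, e n = x.
Proof.
move=> /countable_injP[f f_inj].
have /choice[e eP] : forall n, exists x, forall y, A y -> f y = n -> y = x.
  move=> n; have [[x Ax fx]|nx] := pselect (exists2 x, A x & f x = n).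
    by exists x => y Ay fy; apply: f_inj; rewrite ?inE // fy.
  by exists x0 => y Ay fy; case: nx; exists y.
by exists e => x Ax; exists (f x); rewrite -(eP _ x).
Qed.

Lemma countable_sub_range (T : Type) (A : set T) (e : nat -> T) :
  (forall x, A x -> exists n, e n = x) -> countable A.
Proof.
move=> Ae; have /subset_card_le AR : A `<=` range e.
  by move=> x /Ae[n <-]; exists n.
exact: card_le_trans AR (card_image_le _ _).
Qed.

Lemma infinite_injective_seq (T : Type) (A : set T) :
  infinite_set A <-> exists a : nat -> T, injective a /\ forall n, A (a n).
Proof.
split=> [/infiniteP/card_subP[C /card_set_bijP[f [_ _ f_surj]] CA]|].
  have /choice[a aP] : forall n, exists x, C x /\ f x = n.
    by move=> n; have [x Cx fx] := f_surj n I; exists x.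
  exists a; split=> [m n amn|n]; last exact: CA (aP n).1.
  by rewrite -(aP m).2 amn (aP n).2.
move=> [a [a_inj aA]] Afin; apply: infinite_nat.
rewrite -(eq_finite_set (inj_card_eq (in2W a_inj))).
by apply: sub_finite_set Afin => _ [n _ <-].
Qed.

Lemma R_not_countable : ~ countable [set: R].
Proof.
move=> cR; have iR : infinite_set [set: R].
  by apply/infinite_injective_seq; exists INR; split=> // m n /INR_eq.
have /card_set_bijP[f [_ f_inj f_surj]] := eq_card_nat cR iR.
have /choice[u uK] : forall n, exists x, f x = n.
  by move=> n; have [x _ fx] := f_surj n I; exists x.
apply: (R_uncountable u); exists f; split=> // x.
by apply: f_inj; rewrite ?inE.
Qed.

(** Either [T] injects into the reals, and countable sets have countable preimages, or the reals
    inject into [T], and a left inverse of that injection takes every real value. *)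
Lemma uncountable_real_family (T : Type) : ~ countable [set: T] ->
  exists c : T -> R, forall B : set R, countable B -> exists x, ~ B (c x).
Proof.
move=> ncT; have [[c c_inj]|[g g_inj]] := injection_total T R.
  exists c => B /countable_injP[f f_inj]; apply: contrapT => /forallNP cB.
  apply: ncT; apply/countable_injP; exists (f \o c) => x y _ _ /= fcxy.
  by apply: c_inj; apply: f_inj => //; rewrite inE; exact: contrapT.
have /choice[c cP] : forall x, exists r, forall s, g s = x -> r = s.
  move=> x; have [[r rx]|nr] := pselect (exists r, g r = x).
    by exists r => s; rewrite -rx => /g_inj.
  by exists 0%R => s sx; case: nr; exists s.
exists c => B cB; apply: contrapT => /forallNP cBx.
apply: R_not_countable; apply: (sub_countable _ cB); apply: subset_card_le.
by move=> r _; rewrite -(cP (g r) r) //; exact: contrapT.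
Qed.

(** * Splitting *)

(** Diagonal argument: [S] decreases through infinite sets, each time keeping an infinite side of
    [U n]. Distinct points [b n] of [S n] then lie, up to finitely many, on one side of each
    [U n]. *)
Lemma unsplit_subset (T : Type) (A : set T) (U : nat -> set T) :
  infinite_set A ->
  exists B, [/\ B `<=` A, infinite_set B & forall n, ~ splits (U n) B].
Proof.
move=> Ainf.
pose S := fix S n := if n is n'.+1 then
  (if pselect (infinite_set (S n' `&` U n')) then S n' `&` U n'
   else S n' `\` U n') else A.
have Sinf n : infinite_set (S n).
  elim: n => [//|n IH] /=; case: pselect => // nfin fin'.
  have fin := contrapT nfin.
  by apply: IH; rewrite -(setUIDK (S n) (U n)) finite_setU.
have Sdecr m n : m <= n -> S n `<=` S m.
  elim: n => [|n IH]; first by rewrite leqn0 => /eqP ->.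
  rewrite leq_eqVlt => /orP[/eqP -> //|]; rewrite ltnS => /IH.
  by apply: subset_trans; rewrite /=; case: pselect => _ x [].
(* [next (n, L)] is a point of [S n] outside the finite set [L], which will hold the points chosen
   before. *)
have /choice[next nextP] : forall p : nat * set T, exists x,
    finite_set p.2 -> (S p.1 `\` p.2) x.
  move=> [n L] /=; have [Lfin|?] := pselect (finite_set L).
    by have [x Lx] := infinite_setN0 (infinite_setD (Sinf n) Lfin); exists x.
  by have [x _] := infinite_setN0 Ainf; exists x.
pose L := fix L n := if n is n'.+1 then L n' `|` [set next (n', L n')]
  else set0.
pose b n := next (n, L n).
have Lfin n : finite_set (L n).
  elim: n => [|n IH]; first exact: finite_set0.
  by rewrite /= finite_setU; split=> //; exact: finite_set1.
have bS n : S n (b n) by have [] := nextP (n, L n) (Lfin n).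
have bL m n : m < n -> L n (b m).
  elim: n => [//|n IH]; rewrite ltnS leq_eqVlt => /orP[/eqP ->|/IH]; first by right.
  by left.
have b_neq m n : m < n -> b m <> b n.
  by move=> /bL + e; rewrite e; have [] := nextP (n, L n) (Lfin n).
have b_inj : injective b.
  by move=> m n e; case: (ltngtP m n) => // /b_neq; rewrite e.
exists (range b); split.
- by move=> _ [n _ <-]; apply: (Sdecr 0 n).
- by apply/infinite_injective_seq; exists b; split=> // n; exists n.
- move=> n [inU outU].
  have tail m : L n.+1 (b m) \/ S n.+1 (b m).
    have [/bL ?|mn] := ltnP m n.+1; first by left.
    by right; apply: (Sdecr _ m).
  have [SU|SU] : S n.+1 `<=` U n \/ S n.+1 `<=` ~` U n.
    by rewrite /=; case: pselect => ?; [left|right] => x [].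
    apply: outU; apply: sub_finite_set (Lfin n.+1) => _ [[m _ <-] nU].
    by have [//|/SU] := tail m.
  apply: inU; apply: sub_finite_set (Lfin n.+1) => _ [[m _ <-] Um].
  by have [//|/SU] := tail m.
Qed.

Lemma splitting_family_not_countable (X : topologicalType) (G : set (set X)) :
  infinite_set [set: X] -> splitting_family G -> ~ countable [set: {U | G U}].
Proof.
move=> Xinf [_ Gsplit] cG; have [U0 [GU0 _]] := Gsplit _ Xinf.
have [e eP] := countable_enum (exist _ U0 GU0) cG.
have [B [_ Binf Bunsplit]] := unsplit_subset (fun n => sval (e n)) Xinf.
have [U [GU splitU]] := Gsplit _ Binf.
have [n en] := eP (exist _ U GU) I.
by apply: (Bunsplit n); rewrite en.
Qed.

(** * Cantor schemes in uncountable Polish spaces *)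

Lemma metric_ball_open (X : topologicalType) (d : X -> X -> R) (x : X) (r : R) :
  is_metric d -> metric_generates d -> open [set y | (d x y < r)%R].
Proof.
move=> [_ [_ [_ d_tri]]] gen; apply/gen => y /= dxy.
exists (r - d x y)%R; split; first lra.
by move=> z dyz; have := d_tri x y z; lra.
Qed.

Lemma dense_sequence (X : topologicalType) (d : X -> X -> R) (x0 : X) :
  separable_space X -> is_metric d -> metric_generates d ->
  exists q : nat -> X, forall x e, (0 < e)%R -> exists n, (d x (q n) < e)%R.
Proof.
move=> [D [cD Ddense]] dm gen; have [q qD] := countable_enum x0 cD.
exists q => x e e_gt0.
have [|y [/= dxy /qD[n qn]]] := Ddense _ (metric_ball_open x e dm gen).
  by exists x => /=; rewrite (dm.2.1 x x).2.
by exists n; rewrite qn.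
Qed.

Definition condensation_point (T : Type) (d : T -> T -> R) (x : T) :=
  forall e, (0 < e)%R -> ~ countable [set y | (d x y < e)%R].

(** A point with a countable ball lies in a countable ball centered in a dense sequence with radius
    the inverse of a positive integer; there are countably many of these. *)
Lemma noncondensation_countable (X : topologicalType) (d : X -> X -> R) (x0 : X) :
  separable_space X -> is_metric d -> metric_generates d ->
  countable [set x | ~ condensation_point d x].
Proof.
move=> sep dm gen; have [q q_dense] := dense_sequence x0 sep dm gen.
have [d_ge0 [d_eq0 [d_sym d_tri]]] := dm.
pose W (p : nat * nat) := [set y | (d (q p.1) y < / INR p.2)%R].
pose I := [set p | countable (W p)].
have cWI : countable (\bigcup_(p in I) W p).
  by apply: bigcup_countable => //; exact: countableP.
apply: (sub_countable _ cWI); apply: subset_card_le => x /= /existsNP[e].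
move=> /not_implyP[e_gt0 /contrapT cball].
have [|j [j_lt /lt_INR j_gt0]] := archimed_cor1 (e / 2); first lra.
have jinv_gt0 : (0 < / INR j)%R by apply: Rinv_0_lt_compat.
have [i dxi] := q_dense x _ jinv_gt0.
exists (i, j); last by rewrite /W /= d_sym.
apply: (sub_countable _ cball); apply: subset_card_le => y /=.
by rewrite /W /= => diy; have := d_tri x (q i) y; lra.
Qed.

Lemma condensation_point_near (X : topologicalType) (d : X -> X -> R) (x : X)
    (e : R) :
  separable_space X -> is_metric d -> metric_generates d ->
  condensation_point d x -> (0 < e)%R ->
  exists y, [/\ condensation_point d y, (0 < d x y)%R & (d x y < e)%R].
Proof.
move=> sep dm gen xc e_gt0; apply: contrapT => noy; apply: (xc e e_gt0).
pose W (b : bool) := if b then [set x] else [set x | ~ condensation_point d x].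
have cW : countable (\bigcup_(b in setT) W b).
  apply: bigcup_countable; first exact: countableP.
  by move=> [] _ /=; [exact: countable1|exact: noncondensation_countable].
apply: (sub_countable _ cW); apply: subset_card_le => y /= dxy.
have [yc|nyc] := pselect (condensation_point d y); last by exists false.
exists true => //=; apply/esym/dm.2.1; apply: contrapT => dxy0.
by apply: noy; exists y; split=> //; have := dm.1 x y; lra.
Qed.

(* The last clause is the continuity of [h] for the product topology, stated
   with basic cylinders. *)
Lemma cantor_injection (Y : topologicalType) :
  polish Y -> ~ countable [set: Y] ->
  exists h : (nat -> bool) -> Y, injective h /\
    forall U : set Y, open U -> forall z, U (h z) ->
      exists m, forall z', (forall i, (i < m)%N -> z' i = z i) -> U (h z').
Proof.
move=> [sep [d [dm [gen complete]]]] ncY.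
have [d_ge0 [d_eq0 [d_sym d_tri]]] := dm.
have d_refl x : d x x = 0%R by apply/d_eq0.
have [x0 x0c] : exists x, condensation_point d x.
  apply: contrapT => /forallNP noc; apply: (ncY).
  have [[y0 _]|noY] := pselect ([set: Y] !=set0); last first.
    by apply: (sub_countable _ (countable0 nat)); apply/card_le0P;
      apply/seteqP; split=> // y _; case: noY; exists y.
  apply: (sub_countable _ (noncondensation_countable y0 sep dm gen)).
  by apply: subset_card_le => y _; exact: noc.
have /choice[split splitP] : forall p : Y * R, exists ys : Y * R,
    condensation_point d p.1 -> (0 < p.2)%R ->
    [/\ condensation_point d ys.1, (0 < ys.2)%R, (ys.2 <= p.2 / 2)%R,
        (d p.1 ys.1 + ys.2 <= p.2)%R & (2 * ys.2 < d p.1 ys.1)%R].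
  move=> [x r] /=.
  have [[xc r_gt0]|nxr] := pselect (condensation_point d x /\ (0 < r)%R);
    last by exists (x, r) => xc r_gt0; case: nxr.
  have [|y [yc dxy_gt0 dxy_lt]] := @condensation_point_near _ d x (r / 2) sep dm gen xc.
    lra.
  (* A third of the distance makes the two balls of this radius around [x] and [y] disjoint; since
     [y] is within [r / 2] of [x], both stay in the ball of radius [r]. *)
  exists (y, (d x y / 3)%R) => _ _ /=; split=> //; lra.
(* A node is a closed ball, given by its center and radius, around a condensation
   point; its two successors are disjoint closed balls inside it. *)
pose next (b : bool) (p : Y * R) := (if b then (split p).1 else p.1, (split p).2).
pose node := fix node (z : nat -> bool) n : Y * R :=
  if n is n'.+1 then next (z n') (node z n') else (x0, 1%R).
have node_agree n z z' : (forall i, (i < n)%N -> z' i = z i) ->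
    node z' n = node z n.
  elim: n => [//|n IH] zz' /=; rewrite zz' // IH // => i i_n.
  by apply: zz'; rewrite ltnS ltnW.
have nodeP z n : condensation_point d (node z n).1 /\ (0 < (node z n).2)%R.
  elim: n => [|n [IHc IHr]] /=; first by split=> //; lra.
  by have [? ? _ _ _] := splitP _ IHc IHr; split=> //; case: (z n).
have node_half z n : ((node z n).2 <= (1 / 2) ^ n)%R.
  elim: n => [|n IH] /=; first lra.
  have [_ _ ? _ _] := splitP _ (nodeP z n).1 (nodeP z n).2; lra.
have node_nest z m n : (m <= n)%N ->
    (d (node z m).1 (node z n).1 + (node z n).2 <= (node z m).2)%R.
  elim: n => [|n IH].
    by rewrite leqn0 => /eqP ->; rewrite d_refl; lra.
  rewrite leq_eqVlt => /orP[/eqP ->|]; first by rewrite d_refl; lra.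
  rewrite ltnS => /IH {}IH.
  have [_ ? ? ? _] := splitP _ (nodeP z n).1 (nodeP z n).2.
  have step : (d (node z n).1 (node z n.+1).1 + (node z n.+1).2 <= (node z n).2)%R.
    by rewrite /=; case: (z n) => //=; rewrite d_refl; have := nodeP z n; lra.
  have := d_tri (node z m).1 (node z n).1 (node z n.+1).1; lra.
have small e : (0 < e)%R -> exists n, ((1 / 2) ^ n < e)%R.
  move=> e_gt0; have [|n nP] := @pow_lt_1_zero (1 / 2) _ e e_gt0.
    by rewrite Rabs_right; lra.
  exists n; have := nP n (le_n n); rewrite Rabs_right //.
  by apply/Rle_ge/pow_le; lra.
have /choice[h hP] : forall z, exists l, forall m,
    (d (node z m).1 l <= (node z m).2)%R.
  move=> z; have [|l lP] := complete (fun n => (node z n).1).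
    move=> e e_gt0; have [|n nP] := small (e / 2)%R; first lra.
    exists n => i j ni nj.
    have := node_nest z n i ni; have := node_nest z n j nj.
    have := node_half z n; have := (nodeP z i).2; have := (nodeP z j).2.
    have := d_tri (node z i).1 (node z n).1 (node z j).1.
    rewrite (d_sym (node z i).1 (node z n).1); lra.
  (* Were the limit outside the closed ball of stage [m], a late center, which lies in that ball,
     would be closer to the limit than the positive gap. *)
  exists l => m; apply: Rnot_lt_le => lt.
  have [|n nP] := lP (d (node z m).1 l - (node z m).2)%R; first lra.
  have := nP (maxn m n) (leq_maxr m n).
  have := node_nest z m (maxn m n) (leq_maxl m n).
  have := (nodeP z (maxn m n)).2.
  have := d_tri (node z m).1 (node z (maxn m n)).1 l; lra.
exists h; split=> [z z' hzz'|U Uopen z Uhz].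
  apply: contrapT => zz'.
  have diff : exists n, z n != z' n.
    apply: contrapT => /forallNP nodiff; apply: zz'; apply/funext => n.
    by apply/eqP/negPn/negP/nodiff.
  have [n zn zmin] := ex_minnP diff.
  have en : node z' n = node z n.
    apply: node_agree => i i_n; apply/eqP/negPn/negP => zi.
    by have := zmin i; rewrite eq_sym zi leqNgt i_n => /(_ isT).
  (* At the first difference the two branches leave the same node towards disjoint closed balls, yet
     the common value [h z'] would lie in both. *)
  have [_ _ _ _ apart] := splitP _ (nodeP z n).1 (nodeP z n).2.
  have := hP z n.+1; have := hP z' n.+1; rewrite /= en hzz'.
  have := d_tri (node z n).1 (h z') (split (node z n)).1.
  rewrite (d_sym (h z') (split _).1).
  by case: (z n) (z' n) zn => [] [] //= _; lra.
have [e [e_gt0 eU]] := (gen U).1 Uopen _ Uhz.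
have [|m mP] := small (e / 2)%R; first lra.
exists m => z' zz'; apply: eU.
have := hP z m; have := hP z' m; rewrite (node_agree _ _ _ zz').
have := node_half z m; have := d_tri (h z) (node z m).1 (h z').
rewrite (d_sym (h z) (node z m).1); lra.
Qed.

(** * Coding by generic balls *)

Definition unpair (k : nat) : nat * nat := odflt (0%N, 0%N) (unpickle k).

Lemma unpairK (p : nat * nat) : unpair (pickle p) = p.
Proof. by rewrite /unpair pickleK. Qed.

Definition center (X : Type) (q : nat -> X) (k : nat) : X :=
  q (unpair k).1.

(** The exponential keeps the radius positive for every real [t], lets it tend to 0 with the second
    component of [unpair k], and makes it injective in [t] for fixed [k]. *)
Definition radius (t : R) (k : nat) : R :=
  exp (t - INR (unpair k).2).

Definition ball_code (X : Type) (d : X -> X -> R) (q : nat -> X) (t : R)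
    (x : X) (k : nat) : bool :=
  `[< (d x (center q k) < radius t k)%R >].

Lemma ball_code_inj (X : Type) (d : X -> X -> R) (q : nat -> X) (t : R) :
  is_metric d ->
  (forall x e, (0 < e)%R -> exists n, (d x (q n) < e)%R) ->
  injective (ball_code d q t).
Proof.
move=> [d_ge0 [d_eq0 [d_sym d_tri]]] q_dense x y xy.
apply/d_eq0; apply: contrapT => dxy0.
have dxy_gt0 : (0 < d x y)%R by have := d_ge0 x y; lra.
(* With radius below half of [d x y], no ball of the code contains both points, while density puts
   [x] in one of them. *)
have [j j_large] := INR_unbounded (t - ln (d x y / 2)).
have r_lt : (exp (t - INR j) < d x y / 2)%R.
  rewrite -[X in (_ < X)%R]exp_ln; last lra.
  by apply: exp_increasing; lra.
have [i dxi] := q_dense x _ (exp_pos (t - INR j)).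
have := congr1 (@^~ (pickle (i, j))) xy.
rewrite /ball_code /center /radius unpairK /= (asboolT dxi) => /esym/asboolP.
by have := d_tri x (q i) y; rewrite (d_sym y); lra.
Qed.

Definition generic (X : Type) (d : X -> X -> R) (q : nat -> X) (t : R) (x : X) :=
  forall k, d x (center q k) <> radius t k.

(** For each [n] and [k], taking logarithms shows that at most one [t] puts [a n] on the [k]-th
    sphere. *)
Lemma nongeneric_countable (X : Type) (d : X -> X -> R) (q a : nat -> X) :
  countable [set t | ~ forall n, generic d q t (a n)].
Proof.
pose e m := let: (n, k) := unpair m in
  (ln (d (a n) (center q k)) + INR (unpair k).2)%R.
apply: (@countable_sub_range _ _ e) => t /existsNP[n /existsNP[k /contrapT dnk]].
exists (pickle (n, k)); rewrite /e unpairK dnk /radius ln_exp; lra.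
Qed.

(* The spheres avoided by the first conjunct are those where the code jumps; removing
   them makes this an open subset of the preimage of [U] under the coding. *)
Definition code_preimage (X : Type) (d : X -> X -> R) (q : nat -> X) (t : R)
    (U : set (nat -> bool)) : set X :=
  [set x | exists m, (forall k, (k < m)%N -> d x (center q k) <> radius t k) /\
    forall z, (forall k, (k < m)%N -> z k = ball_code d q t x k) -> U z].

Lemma code_preimage_open (X : topologicalType) (d : X -> X -> R) (q : nat -> X)
    (t : R) (U : set (nat -> bool)) :
  is_metric d -> metric_generates d -> open (code_preimage d q t U).
Proof.
move=> [d_ge0 [d_eq0 [d_sym d_tri]]] gen; apply/gen => x [m [xm xU]].
have [e [e_gt0 eP]] : exists e, (0 < e)%R /\ forall y, (d x y < e)%R ->
    forall k, (k < m)%N -> d y (center q k) <> radius t k /\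
      ball_code d q t y k = ball_code d q t x k.
  elim: m xm {xU} => [|m IH] xm; first by exists 1%R; split=> //; lra.
  have [k k_m|e [e_gt0 eP]] := IH; first by apply: xm; rewrite ltnS ltnW.
  have xm_neq := xm m (ltnSn m).
  (* Moving by less than the distance to the sphere of index [m] cannot cross it, so bit [m] is
     unchanged. *)
  exists (Rmin e (Rabs (d x (center q m) - radius t m))); split.
    by apply: Rmin_pos => //; apply: Rabs_pos_lt; lra.
  move=> y + k; have := Rmin_l e (Rabs (d x (center q m) - radius t m)).
  have := Rmin_r e (Rabs (d x (center q m) - radius t m)).
  move: (Rmin _ _) => r min_r min_l dxy.
  rewrite ltnS leq_eqVlt => /orP[/eqP ->|]; last by apply: eP; lra.
  have := d_tri x y (center q m); have := d_tri y x (center q m).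
  rewrite (d_sym y x) => tri1 tri2; rewrite /ball_code.
  case: (Rle_or_lt (radius t m) (d x (center q m))) => side.
    rewrite Rabs_right in min_r; last lra.
    by split; [lra|rewrite !asboolF //; lra].
  rewrite Rabs_left in min_r; last lra.
  by split; [lra|rewrite !asboolT //; lra].
exists e; split=> // y /eP yP; exists m; split=> [k /yP[]//|z zP].
by apply: xU => k k_m; rewrite zP //; have [_ ->] := yP k k_m.
Qed.

Lemma code_preimageE (X : Type) (d : X -> X -> R) (q : nat -> X) (t : R)
    (U : set (nat -> bool)) (x : X) :
  (forall z, U z -> exists m, forall z', (forall i, (i < m)%N -> z' i = z i) -> U z') ->
  generic d q t x ->
  code_preimage d q t U x <-> U (ball_code d q t x).
Proof.
move=> Uopen xgen; split=> [[m [_ mU]]|/Uopen[m mU]]; first exact: mU.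
by exists m; split=> // k _; exact: xgen.
Qed.

(** * Transfer of splitting families *)

Lemma s_le_uncountable_polish (X Y : topologicalType) :
  polish X -> polish Y -> ~ countable [set: Y] -> s_le X Y.
Proof.
move=> [sepX [d [dm [gen _]]]] polY ncY G Gsplit.
have [[x0 _]|noX] := pselect ([set: X] !=set0); last first.
  exists set0; split; last exact: card_ge0.
  by split=> // A /infinite_setN0[x _]; case: noX; exists x.
have [q q_dense] := dense_sequence x0 sepX dm gen.
have [h [h_inj h_cont]] := cantor_injection polY ncY.
have infY : infinite_set [set: Y] by move=> /finite_set_countable.
have ncG := splitting_family_not_countable infY Gsplit.
have [c cP] := uncountable_real_family ncG.
have [u [u_inj _]] : exists u : nat -> {U | G U}, injective u /\
    forall n, [set: {U | G U}] (u n).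
  by apply/infinite_injective_seq => /finite_set_countable.
have [f f_inj] := injective_square u_inj.
pose V (U1 U2 : {U | G U}) := code_preimage d q (c U1) (h @^-1` sval U2).
exists [set W | exists U1 U2, W = V U1 U2]; split; last first.
  (* [g] decodes a member of [G] into the open set of the pair that [f] sends to it, by default the
     empty set; the image of [G] under [g] thus covers the new family. *)
  have /choice[g gP] : forall S, exists W, forall U1 U2,
      sval (f U1 U2) = S -> W = V U1 U2.
    move=> S; have [[U1 [U2 fS]]|nf] :=
        pselect (exists U1 U2, sval (f U1 U2) = S).
      exists (V U1 U2) => U1' U2'; rewrite -fS => /sval_inj/f_inj[-> ->].
      by [].
    by exists set0 => U1 U2 fS; case: nf; exists U1, U2.
  apply: (card_le_trans _ (card_image_le g G)); apply: subset_card_le.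
  move=> _ [U1 [U2 ->]]; exists (sval (f U1 U2)); first exact: (svalP (f _ _)).
  exact: gP.
split=> [_ [U1 [U2 ->]]|A /infinite_injective_seq[a [a_inj aA]]].
  exact: code_preimage_open.
(* The parameter [c U1] avoids the countably many reals that are bad for [a], so every [a n] is
   generic. *)
have [U1 /contrapT U1gen] := cP _ (nongeneric_countable d q a).
pose b n := h (ball_code d q (c U1) (a n)).
have b_inj : injective b by move=> m n /h_inj/(ball_code_inj dm q_dense)/a_inj.
have binf : infinite_set (range b).
  by apply/infinite_injective_seq; exists b; split=> // n; exists n.
have [U2 [GU2 [inU outU]]] := Gsplit.2 _ binf.
exists (V U1 (exist _ U2 GU2)); split; first by exists U1, (exist _ U2 GU2).
have VE n : V U1 (exist _ U2 GU2) (a n) <-> U2 (b n).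
  apply: code_preimageE; last exact: U1gen.
  by move=> z /(h_cont _ (Gsplit.1 _ GU2)).
(* As [a] is injective, a finite trace of [P] on [A] involves finitely many indices [n], and their
   points [b n] exhaust the trace of [Q]. *)
have transfer (P : set X) (Q : set Y) : (forall n, Q (b n) -> P (a n)) ->
    infinite_set (range b `&` Q) -> infinite_set (A `&` P).
  move=> QP Qinf Pfin; apply: Qinf.
  have : finite_set (a @^-1` (A `&` P)).
    by apply: finite_preimage Pfin => m n _ _ /a_inj.
  move=> /(finite_image b); apply: sub_finite_set => _ [[n _ <-] Qn].
  by exists n => //; split; [exact: aA|exact: QP].
by split; [apply: transfer inU|apply: transfer outU] => n; rewrite /= VE.
Qed.

Theorem theorem2p5 (X Y : topologicalType) :
  polish X -> polish Y ->
  ~ countable [set: X] -> ~ countable [set: Y] ->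
  s_eq X Y.
Proof.
by move=> polX polY ncX ncY; split; exact: s_le_uncountable_polish.
Qed.
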